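(* For every pGCL program $P$ and every $F\in\mathsf{FPS}$, $|[\![P]\!](F)|\le|F|$.
   Context: Fix $k\ge1$ and formal indeterminates $X_1,\dots,X_k$; for $\sigma\in\mathbb{N}^k$, $X^\sigma=X_1^{\sigma_1}\cdots X_k^{\sigma_k}$. $\mathsf{FPS}$ is the set of formal sums $F=\sum_{\sigma\in\mathbb{N}^k}[\sigma]_F X^\sigma$ with $[\sigma]_F\in[0,\infty]$; addition and multiplication by scalars $r\in[0,\infty]$ are coefficient-wise (with $0\cdot\infty=0$). The mass of $F$ is $|F|=\sum_{\sigma\in\mathbb{N}^k}[\sigma]_F\in[0,\infty]$. $F\preceq G$ iff $[\sigma]_F\le[\sigma]_G$ for all $\sigma$; transformers $\mathsf{FPS}\to\mathsf{FPS}$ are ordered pointwise by $\sqsubseteq$. For $B\subseteq\mathbb{N}^k$, $\langle F\rangle_B=\sum_{\sigma\in B}[\sigma]_F X^\sigma$ and $\neg B=\mathbb{N}^k\setminus B$. pGCL programs over variables $x_1,\dots,x_k$ (ranging over $\mathbb{N}$): $P::=\mathtt{skip}\mid x_i:=E\mid P;P\mid \{P\}[p]\{P\}\mid \mathtt{if}(B)\{P\}\mathtt{else}\{P\}\mid \mathtt{while}(B)\{P\}$, with $E$ an arithmetic expression with value $\mathrm{eval}_\sigma(E)\in\mathbb{N}$ in state $\sigma$, $p\in[0,1]$, guards $B\subseteq\mathbb{N}^k$. Semantics $[\![P]\!]:\mathsf{FPS}\to\mathsf{FPS}$: $[\![\mathtt{skip}]\!](F)=F$; $[\![x_i:=E]\!](F)=\sum_{\sigma}[\sigma]_F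 X_1^{\sigma_1}\cdots X_i^{\mathrm{eval}_\sigma(E)}\cdots X_k^{\sigma_k}$; $[\![\{P_1\}[p]\{P_2\}]\!](F)=p[\![P_1]\!](F)+(1-p)[\![P_2]\!](F)$; $[\![\mathtt{if}(B)\{P_1\}\mathtt{else}\{P_2\}]\!](F)=[\![P_1]\!](\langle F\rangle_B)+[\![P_2]\!](\langle F\rangle_{\neg B})$; $[\![P_1;P_2]\!](F)=[\![P_2]\!]([\![P_1]\!](F))$; $[\![\mathtt{while}(B)\{P\}]\!]$ is the $\sqsubseteq$-least fixed point of $\Phi_{B,P}(\psi)=\lambda F.\ \langle F\rangle_{\neg B}+\psi([\![P]\!](\langle F\rangle_B))$. *)

(* Defs.v *)
From mathcomp Require Import all_boot all_order all_algebra.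
From mathcomp Require Import all_classical all_reals all_analysis.

Set Implicit Arguments.
Unset Strict Implicit.
Unset Printing Implicit Defensive.

Import Order.TTheory GRing.Theory Num.Theory.
Local Open Scope classical_set_scope.
Local Open Scope ring_scope.
Local Open Scope ereal_scope.

(* A state is also the multi-index of the monomial X^s. *)
Definition state (k : nat) : Type := {ffun 'I_k -> nat}.

Definition update k (s : state k) (i : 'I_k) (n : nat) : state k :=
  [ffun j => if j == i then n else s j].

Record fps (R : realType) (k : nat) := Fps {
  coef :> state k -> \bar R;
  coef_ge0 : forall s, 0 <= coef s }.

Section FormalPowerSeries.
Variables (R : realType) (k : nat).
Local Notation state := (state k).
Local Notation fps := (fps R k).
Implicit Types (F G : fps) (B : set state).

Lemma fps_ext F G : (forall s, F s = G s) -> F = G.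
Proof.
case: F G => [f f0] [g g0] /= /funext fg; case: _ / fg g0 => g0.
by congr Fps; exact: Prop_irrelevance.
Qed.

Definition fps_le F G : Prop := forall s, F s <= G s.

Definition mass F : \bar R := \esum_(s in [set: state]) F s.

Definition fps_add F G : fps :=
  Fps (fun s => adde_ge0 (coef_ge0 F s) (coef_ge0 G s)).

Definition fps_scale (r : \bar R) (r_ge0 : 0 <= r) F : fps :=
  Fps (fun s => mule_ge0 r_ge0 (coef_ge0 F s)).

Definition fps_sum (G : state -> fps) : fps :=
  @Fps R k (fun t => \esum_(s in [set: state]) G s t)
    (fun t => esum_ge0 (fun s _ => coef_ge0 (G s) t)).

Lemma monomial_subproof (s t : state) :
  0 <= (if t == s then 1 else 0 : \bar R).
Proof. by case: ifP. Qed.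

Definition monomial (s : state) : fps := Fps (monomial_subproof s).

Lemma fps_restrict_subproof B F s : 0 <= (if s \in B then F s else 0).
Proof. by case: ifP => // _; exact: coef_ge0. Qed.

Definition fps_restrict B F : fps := Fps (fps_restrict_subproof B F).

Definition transformer := fps -> fps.

Definition transformer_le (S T : transformer) : Prop :=
  forall F, fps_le (S F) (T F).

Definition is_lfp (Phi : transformer -> transformer) (psi : transformer) :=
  Phi psi = psi /\ forall psi', Phi psi' = psi' -> transformer_le psi psi'.

Definition loop_functional B (f psi : transformer) : transformer :=
  fun F => fps_add (fps_restrict (~` B) F) (psi (f (fps_restrict B F))).

Lemma loop_lfp_exists B (f : transformer) :
  exists psi, is_lfp (loop_functional B f) psi.
Proof.
set Phi := loop_functional B f.
pose pre : set transformer := [set psi | transformer_le (Phi psi) psi].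
have inf_ge0 F s : 0 <= ereal_inf [set psi F s | psi in pre].
  by apply: le_ereal_inf_tmp => _ [psi _ <-]; exact: coef_ge0.
pose m : transformer := fun F => Fps (inf_ge0 F).
have m_lb psi : pre psi -> transformer_le m psi.
  by move=> ppsi F s; apply: ereal_inf_lbound; exists psi.
have Phi_mono S T : transformer_le S T -> transformer_le (Phi S) (Phi T).
  by move=> ST F s; rewrite /= leeD2l//; exact: ST.
have m_pre : pre m.
  move=> F s; apply: le_ereal_inf_tmp => _ [psi ppsi <-].
  exact: le_trans (Phi_mono _ _ (m_lb _ ppsi) F s) (ppsi F s).
have m_fix : Phi m = m.
  apply/funext => F; apply: fps_ext => s; apply/eqP; rewrite eq_le m_pre.
  by apply: (m_lb (Phi m)); exact: Phi_mono.
exists m; split=> // psi psiE; apply: m_lb => F s; by rewrite psiE.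
Qed.

(* The choice made by cid is immaterial: least fixed points are unique. *)
Definition loop_lfp B (f : transformer) : transformer :=
  sval (cid (loop_lfp_exists B f)).

End FormalPowerSeries.

(* Arithmetic expressions are identified with their evaluation functions, so
   eval_s(E) is E s; guards are likewise sets of states. *)
Inductive pgcl (R : realType) (k : nat) : Type :=
| PSkip
| PAssign of 'I_k & (state k -> nat)
| PSeq of pgcl R k & pgcl R k
| PChoice of {i01 R} & pgcl R k & pgcl R k
| PIf of set (state k) & pgcl R k & pgcl R k
| PWhile of set (state k) & pgcl R k.

Section Semantics.
Variables (R : realType) (k : nat).
Local Notation fps := (fps R k).

Definition fps_assign (i : 'I_k) (E : state k -> nat) (F : fps) : fps :=
  fps_sum (fun s => fps_scale (coef_ge0 F s) (monomial R (update s i (E s)))).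

Lemma i01_ge0 (p : {i01 R}) : 0 <= p%:num%:E.
Proof. by rewrite lee_fin. Qed.

Lemma i01_onem_ge0 (p : {i01 R}) : 0 <= (1 - p%:num)%:E.
Proof. by rewrite lee_fin subr_ge0. Qed.

Fixpoint sem (P : pgcl R k) : fps -> fps :=
  match P with
  | PSkip => fun F => F
  | PAssign i E => fps_assign i E
  | PSeq P1 P2 => fun F => sem P2 (sem P1 F)
  | PChoice p P1 P2 => fun F =>
      fps_add (fps_scale (i01_ge0 p) (sem P1 F))
              (fps_scale (i01_onem_ge0 p) (sem P2 F))
  | PIf B P1 P2 => fun F =>
      fps_add (sem P1 (fps_restrict B F)) (sem P2 (fps_restrict (~` B) F))
  | PWhile B P1 => loop_lfp B (sem P1)
  end.

End Semantics.

(* Main.v *)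
(** A while loop started in [F] outputs the sum over [n] of the mass that leaves
    the loop after exactly [n] iterations.  If the body does not increase mass,
    the partial sums are at most [mass F], since the mass still inside the loop
    can be added to them without exceeding [mass F].  That sum is a fixed point of the
    loop functional, so it bounds the least one from above. *)
Require Import Defs.
From mathcomp Require Import all_boot all_order all_algebra.
From mathcomp Require Import all_classical all_reals all_analysis.

Set Implicit Arguments.
Unset Strict Implicit.
Unset Printing Implicit Defensive.

Import Order.TTheory GRing.Theory Num.Theory.
Local Open Scope classical_set_scope.
Local Open Scope ring_scope.
Local Open Scope ereal_scope.

(** Tonelli for nonnegative families: both sides are sums over a product of index sets, matched by
    exchanging coordinates. *)
Lemma esum_swap (R : realType) (T1 T2 : choiceType) (I : set T1) (J : set T2)
    (a : T1 -> T2 -> \bar R) : (forall i j, 0 <= a i j) ->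
  \esum_(i in I) \esum_(j in J) a i j = \esum_(j in J) \esum_(i in I) a i j.
Proof.
move=> a_ge0; rewrite !esum_esum//.
rewrite (@reindex_esum _ _ _ (J `*`` fun=> I) _ (fun x => (x.2, x.1)))//; split.
- by move=> [j i] /= [].
- by move=> [i1 j1] [i2 j2] _ _ [-> ->].
- by move=> [i j] [Ii Jj]; exists (j, i).
Qed.

Section Mass.
Variables (R : realType) (k : nat).
Implicit Types (F G : fps R k) (B : set (state k)).

Lemma mass_ge0 F : 0 <= mass F.
Proof. by apply: esum_ge0 => s _; exact: coef_ge0. Qed.

Lemma le_mass F G : fps_le F G -> mass F <= mass G.
Proof. by move=> FG; apply: le_esum => s _; exact: FG. Qed.

Lemma massD F G : mass (fps_add F G) = mass F + mass G.
Proof. by rewrite /mass esumD// => s _; exact: coef_ge0. Qed.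

(** The mass is a supremum of finite sums, and [r] distributes over each of these, even when [r] is
    infinite. *)
Lemma massZ_le (r : \bar R) (r_ge0 : 0 <= r) F :
  mass (fps_scale r_ge0 F) <= r * mass F.
Proof.
apply: ge_ereal_sup => _ [X XT <-] /=.
rewrite -ge0_mule_fsumr; last by move=> s; exact: coef_ge0.
by apply: lee_wpmul2l => //; apply: ereal_sup_ubound; exists X.
Qed.

Lemma mass_monomial (s : state k) : mass (monomial R s) = 1.
Proof.
rewrite -[RHS](@esum_set1 R (state k) s (fun=> 1))// esum_mkcond.
by apply: eq_esum => t _ /=; rewrite in_set1.
Qed.

Lemma mass_restrictID B F :
  mass (fps_restrict B F) + mass (fps_restrict (~` B) F) = mass F.
Proof.
rewrite -massD; congr mass; apply: fps_ext => s /=.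
by rewrite in_setC; case: (s \in B); rewrite ?adde0 ?add0e.
Qed.

Lemma mass_sum (G : state k -> fps R k) :
  mass (fps_sum G) = \esum_(s in [set: state k]) mass (G s).
Proof. by rewrite /mass esum_swap// => t s; exact: coef_ge0. Qed.

(** Several states may be sent to the same one, so the mass is summed over source states: each [s]
    contributes [F s] times a monomial of mass 1. *)
Lemma mass_assign_le i E F : mass (fps_assign i E F) <= mass F.
Proof.
rewrite mass_sum; apply: le_esum => s _.
by apply: le_trans (massZ_le _ _) _; rewrite mass_monomial mule1.
Qed.

Section Loop.
Variables (B : set (state k)) (f : transformer R k).

(** The recursion peels off the first iteration rather than the last, as [loop_functional] does. *)
Fixpoint loop_iter (n : nat) F : fps R k :=
  if n is n'.+1 then loop_iter n' (f (fps_restrict B F)) else F.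

Definition loop_exit (n : nat) F := fps_restrict (~` B) (loop_iter n F).

Lemma loop_series_ge0 F s : 0 <= \sum_(n <oo) loop_exit n F s.
Proof. by apply: nneseries_ge0 => n _ _; exact: coef_ge0. Qed.

Definition loop_series : transformer R k := fun F => Fps (loop_series_ge0 F).

Lemma loop_series_fixed : loop_functional B f loop_series = loop_series.
Proof.
apply/funext => F; apply: fps_ext => s /=.
have exit_ge0 n : 0 <= loop_exit n F s by exact: coef_ge0.
(* The term of index 0 is the immediate exit; the others, shifted by one, form the series started in
   [f (fps_restrict B F)]. *)
rewrite [RHS]nneseries_recl; [|by move=> n _; exact: exit_ge0|by []]; congr (_ + _).
rewrite -nneseries_addn; last exact: exit_ge0.
by apply: eq_eseriesr => n _; rewrite addn1.
Qed.

Hypothesis f_le : forall F, mass (f F) <= mass F.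

Lemma loop_exit_sum_le n F : \sum_(0 <= i < n) mass (loop_exit i F) <= mass F.
Proof.
elim: n F => [|n IHn] F; first by rewrite big_nil mass_ge0.
(* The first exit takes the part of [F] outside [B]; the later ones are bounded by the induction
   hypothesis at [f (fps_restrict B F)]. *)
rewrite big_nat_recl//= -(mass_restrictID B F) addeC leeD//.
exact: le_trans (IHn _) (f_le _).
Qed.

Lemma mass_loop_series_le F : mass (loop_series F) <= mass F.
Proof.
have -> : mass (loop_series F) = \sum_(n <oo) mass (loop_exit n F).
  rewrite nneseries_esumT; last by move=> n; exact: mass_ge0.
  rewrite /mass esum_swap; last by move=> *; exact: coef_ge0.
  apply: eq_esum => s _ /=; rewrite nneseries_esumT// => n.
  exact: (coef_ge0 (loop_exit n F)).
apply: lime_le; first by apply: is_cvg_nneseries => n _ _; exact: mass_ge0.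
by apply: nearW => n; exact: loop_exit_sum_le.
Qed.

Lemma mass_loop_lfp_le F : mass (loop_lfp B f F) <= mass F.
Proof.
apply: le_trans (mass_loop_series_le F); apply: le_mass.
rewrite /loop_lfp; case: cid => psi /= [_ psi_least].
exact: psi_least loop_series_fixed F.
Qed.

End Loop.
End Mass.

Theorem theorem3 (R : realType) (k : nat) (k_ge1 : (1 <= k)%N)
    (P : pgcl R k) (F : fps R k) :
  (mass (sem P F) <= mass F)%E.
Proof.
elim: P F => [|i E|P1 IH1 P2 IH2|p P1 IH1 P2 IH2|B P1 IH1 P2 IH2|B P1 IH1] F //=.
- exact: mass_assign_le.
- exact: le_trans (IH2 _) (IH1 _).
- rewrite massD.
  (* Since [mass F] may be infinite, distributivity here rests on both weights being nonnegative. *)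
  have -> : mass F = p%:num%:E * mass F + (1 - p%:num)%:E * mass F.
    rewrite -ge0_muleDl ?i01_ge0 ?i01_onem_ge0//.
    by rewrite -EFinD addrC subrK mul1e.
  by apply: leeD; (apply: le_trans (massZ_le _ _) _; apply: lee_wpmul2l;
    rewrite ?i01_ge0 ?i01_onem_ge0).
- by rewrite massD -(mass_restrictID B F) leeD.
- exact: mass_loop_lfp_le.
Qed.
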